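(* Let $q$ be a power of $2$ and let $f = a\mathtt{x} + b\mathtt{x}^q + \mathtt{x}^{2q-1} \in \mathbb{F}_q[\mathtt{x}]$ (so $a,b\in\mathbb{F}_q$). Then $f$ is a permutation polynomial of $\mathbb{F}_{q^2}$ if and only if one of the following is satisfied: (i) $q > 2$, $a \neq 1$, $\mathrm{Tr}_{q/2}\bigl(\frac{1}{a+1}\bigr) = 0$, and $b^2 = a^2 + a$; (ii) $q > 2$, $a = 1$, $b \neq 0$, and $\mathrm{Tr}_{q/2}\bigl(\frac{1}{b}\bigr) = 0$.
   Context: $\mathbb{F}_q$ is the finite field with $q$ elements. A polynomial $f$ with coefficients in a finite field $F$ is called a permutation polynomial of $F$ if the map $F\to F$, $x\mapsto f(x)$, is a bijection; here $f\in\mathbb{F}_q[\mathtt{x}]$ is viewed as a polynomial over $\mathbb{F}_{q^2}$. $\mathrm{Tr}_{q/2}:\mathbb{F}_q\to\mathbb{F}_2$ denotes the absolute trace. *)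

(* Defs.v *)
From HB Require Import structures.
From mathcomp Require Import all_boot all_algebra all_fingroup all_solvable all_field.

Set Implicit Arguments.
Unset Strict Implicit.
Unset Printing Implicit Defensive.

Import GRing.Theory.
Local Open Scope ring_scope.

Definition permutation_poly (K : finFieldType) (p : {poly K}) : Prop :=
  bijective (fun x : K => p.[x]).

(* Absolute trace of a finite field K of characteristic p, #|K| = p ^ n:
   x + x ^ p + ... + x ^ (p ^ (n - 1)).  The value, which lies in the prime
   subfield, is taken as an element of K.  The explicit argument p is meant to
   be the characteristic of K. *)
Definition abs_trace (p : nat) (K : finFieldType) (x : K) : K :=
  \sum_(i < logn p #|K|) x ^+ (p ^ i).

Lemma abs_trace_galTrace (p : nat) (K : finFieldType) (charK : p \in [pchar K])
    (x : K) :
  abs_trace p x = galTrace 1%VS {: pPrimeCharType charK} x.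
Proof.
pose L : splittingFieldType 'F_p := pPrimeCharType charK.
have p_pr : prime p := pcharf_prime charK.
have [s gen_s Ds] := finField_galois_generator (subvf (1%AS : {subfield L})).
have ord1 : (#|'F_p| ^ \dim (1%VS : {vspace L}))%N = p.
  by rewrite dimv1 expn1 card_Fp.
have ordS : #[s]%g = logn p #|K|.
  rewrite /order -(eqP gen_s) -galois_dim ?finField_galois ?subvf //.
  by rewrite dimv1 divn1 pprimeChar_dimf.
have DsX i (y : L) : (s ^+ i)%g y = y ^+ (p ^ i).
  elim: i => [|i IHi]; first by rewrite expg0 gal_id expr1.
  by rewrite expgSr galM ?memvf // IHi Ds ?memvf // ord1 -exprM expnSr.
rewrite /galTrace (eqP gen_s) /abs_trace -ordS.
have -> : <[s]>%g = [set (s ^+ i)%g | i : 'I_#[s]%g].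
  apply/setP=> g; apply/idP/imsetP => [/cyclePmin[i lt_i ->]|[i _ ->]].
    by exists (Ordinal lt_i).
  exact: mem_cycle.
rewrite big_imset /= => [|i j _ _ /eqP]; last first.
  by rewrite eq_expg_mod_order !modn_small // => /eqP/val_inj.
by apply: eq_bigr => i _; rewrite DsX.
Qed.

(* Main.v *)
Require Import Defs.
From HB Require Import structures.
From mathcomp Require Import all_boot all_algebra all_fingroup all_solvable all_field.
From mathcomp Require Import ring.

(** Write [c = a + b + 1], let [bar x = x ^ q], and let [mu] be the group of
    elements [y] with [bar y * y = 1].  The proof shows that [f] is injective
    exactly when

      [c <> 0],  [Tr (1 / c) = 0]  and  [b ^ 2 = a * c ^ 2];

    splitting on [a = 1] turns these into conditions (i) and (ii)
    ([conditions_split]); [Tr (1 / c) = 0] with [c <> 0] forces [q > 2].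

    Reduction to a conic.  For [x <> 0] put [y = bar x / x], an element of [mu].
    Then [f x = x * (a + b y + y ^ 2)] and [bar (f x) / f x] is the cubic rational
    function [(a y^2 + b y + 1) / (y^3 + b y^2 + a y)] of [y].  As [f] is
    homogeneous over F_q, it is injective iff it has no nonzero root and the
    cubic is injective on [mu].  Cross-multiplying and dividing by [y1 + y2]
    leaves a polynomial in [y1 + y2] and [y1 y2].  In characteristic 2 every
    element of [mu] is a square, so one can write [y1 = r z], [y2 = r / z] with
    [r], [z] in [mu]; in terms of [t = z + 1/z] and [w = r + 1/r], elements of F_q,
    a collision becomes a point of the conic

      [t ^ 2 + b w t + a w ^ 2 = c ^ 2]

    ([collision_conic]).  A nonzero [t] in F_q is of the form [z + 1/z] with [z] in
    [mu] iff [Tr (1 / t) = 1].  So the cubic fails to be injective on [mu] iff the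
    conic has a point with [Tr (1 / t) = 1] and ([w = 0] or [Tr (1 / w) = 1]).

    Sufficiency.  If [g ^ 2 + g = 1 / c ^ 2] and [b ^ 2 = a c ^ 2], then at each
    point of the conic with [t <> 0] the square [1 / t ^ 2] equals [d ^ 2 + d] for
    an explicit [d] in F_q ([conic_inv_artin_schreier]).  So it has trace 0, and so
    has its root [1 / t]: there is no collision.
    Nonzero roots are excluded in the same way ([trinomial_root_free]).

    Necessity.  [f 1 = c] gives [c <> 0], and the point [w = 0], [t = c] gives
    [Tr (1 / c) = 0].  Parametrise the conic from that point by [n] (for [b = 0] it
    is a double line, [conic_point_b0]).  Up to trace-zero terms and a constant,
    [1 / t] becomes [ka / n] and [1 / w] becomes [la * n], with [ka] and [la]
    nonzero when [b ^ 2 <> a c ^ 2].  It remains to find [n] with both traces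
    prescribed.  No estimate of Kloosterman sums is needed: if [Tr (h / k)], with
    [h <> 0], were constant on the [q / 2] elements [k] of trace 1, then
    multiplying by [k ^ (q / 2)] would give a nonzero polynomial of degree less
    than [q / 2] with [q / 2] roots ([trace_inv_nonconstant]).  This works for
    [q >= 8]; for [q = 4] a point is exhibited directly. *)

Import GRing.Theory.
Local Open Scope ring_scope.

Set Implicit Arguments.
Unset Strict Implicit.
Unset Printing Implicit Defensive.

(** * Characteristic 2 *)

Section Char2.

Lemma natr_double_eq0 (R : nzRingType) (charR : 2%N \in [pchar R]) n :
  n.*2%:R = 0 :> R.
Proof. by rewrite -mul2n natrM (pcharf0 charR) mul0r. Qed.

Lemma eq_pchar2 (R : nzRingType) (charR : 2%N \in [pchar R]) (x y : R) :
  x + y = 0 -> x = y.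
Proof. by move/eqP; rewrite addr_eq0 (oppr_pchar2 charR) => /eqP. Qed.

Lemma exprD_frobenius (R : comNzRingType) (charR : 2%N \in [pchar R])
    i (x y : R) :
  (x + y) ^+ (2 ^ i) = x ^+ (2 ^ i) + y ^+ (2 ^ i).
Proof. by rewrite exprDn_pchar // pnatX pnatE ?charR. Qed.

Lemma sqrrD_pchar2 (R : comNzRingType) (charR : 2%N \in [pchar R])
    (x y : R) : (x + y) ^+ 2 = x ^+ 2 + y ^+ 2.
Proof. exact: (exprD_frobenius charR 1). Qed.

Lemma telescope_artin_schreier (R : comNzRingType)
    (charR : 2%N \in [pchar R]) (u : R) n :
  \sum_(i < n) (u ^+ 2 + u) ^+ (2 ^ i) = u ^+ (2 ^ n) + u.
Proof.
elim: n => [|n IHn]; first by rewrite big_ord0 expr1 (addrr_pchar2 charR).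
rewrite big_ord_recr /= IHn (exprD_frobenius charR) -exprM -expnS.
by rewrite [X in _ + X = _]addrC addrACA (addrr_pchar2 charR) add0r addrC.
Qed.

Variables (K : fieldType).
Hypothesis charK : 2%N \in [pchar K].

Lemma sqr_inj_pchar2 : injective (fun x : K => x ^+ 2).
Proof.
move=> x y /= exy; apply: (eq_pchar2 charK); apply/eqP.
by rewrite -sqrf_eq0 (sqrrD_pchar2 charK) /= exy (addrr_pchar2 charK).
Qed.

Lemma sqrr_eq1_pchar2 (x : K) : x ^+ 2 = 1 -> x = 1.
Proof.
by rewrite -[RHS in _ = RHS -> _](expr1n _ 2); apply: sqr_inj_pchar2.
Qed.

Lemma add_inv_neq0 (z : K) : z != 0 -> z != 1 -> z + z^-1 != 0.
Proof.
move=> z0; apply: contraNneq => /(eq_pchar2 charK) zV.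
by apply/eqP/sqrr_eq1_pchar2; rewrite expr2 {2}zV mulfV.
Qed.

End Char2.


(** Two polynomial expressions agree in characteristic 2 iff all integer
    coefficients of their sum are even.  [ring] only discards a coefficient that
    is literally the left-hand side of a given equation, hence one equation for
    each even coefficient that may occur. *)
Ltac char2_ring charK :=
  apply: (eq_pchar2 charK);
  let K := lazymatch type of charK with is_true (_ \in [pchar ?K]) => K end in
  let e2 := fresh in let e4 := fresh in let e6 := fresh in let e8 := fresh in
  have e2 : 2 = 0 :> K := natr_double_eq0 charK 1;
  have e4 : 4 = 0 :> K := natr_double_eq0 charK 2;
  have e6 : 6 = 0 :> K := natr_double_eq0 charK 3;
  have e8 : 8 = 0 :> K := natr_double_eq0 charK 4;
  ring: e2 e4 e6 e8.

(** The quadratic form whose level [(a + b + 1) ^ 2] parametrises the pairs of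
    points of the norm-one group with equal image. *)
Definition conic (R : pzRingType) (a b t w : R) :=
  t ^+ 2 + b * w * t + a * w ^+ 2.

(** * The absolute trace in characteristic 2 *)

Section AbsTrace2.
Variables (K : finFieldType) (m : nat).
Hypothesis cardK : #|K| = (2 ^ m)%N.

Let charK : 2%N \in [pchar K] := card_finPcharP cardK isT.
Notation tr := (@abs_trace 2 K).

Lemma abs_traceE x : tr x = \sum_(i < m) x ^+ (2 ^ i).
Proof. by rewrite /abs_trace cardK pfactorK. Qed.

Lemma abs_trace0 : tr 0 = 0.
Proof. by rewrite abs_traceE big1 // => i _; rewrite expr0n expn_eq0. Qed.

Lemma abs_traceD : {morph tr : x y / x + y}.
Proof.
move=> x y; rewrite !abs_traceE -big_split /=.
by apply: eq_bigr => i _; rewrite (exprD_frobenius charK).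
Qed.

Lemma expf_card2 (x : K) : x ^+ (2 ^ m) = x.
Proof. by rewrite -cardK expf_card. Qed.

Lemma abs_trace1_neq0 x : tr x = 1 -> x != 0.
Proof. by apply: contra_eq_neq => ->; rewrite abs_trace0 eq_sym oner_eq0. Qed.

Lemma abs_trace_artin_schreier u : tr (u ^+ 2 + u) = 0.
Proof.
rewrite abs_traceE (telescope_artin_schreier charK) expf_card2.
exact: (addrr_pchar2 charK).
Qed.

Lemma abs_trace_sqr x : tr (x ^+ 2) = tr x.
Proof.
apply: (eq_pchar2 charK).
by rewrite -abs_traceD abs_trace_artin_schreier.
Qed.

Lemma abs_trace_bool x : tr x = 0 \/ tr x = 1.
Proof.
have tr2 : tr x ^+ 2 = tr x.
  rewrite -[RHS]abs_trace_sqr !abs_traceE.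
  rewrite (big_morph _ (sqrrD_pchar2 charK) (expr0n _ 2)).
  by apply: eq_bigr => i _; rewrite exprAC.
have /eqP : tr x * (tr x - 1) = 0 by rewrite mulrBr mulr1 -expr2 tr2 subrr.
by rewrite mulf_eq0 subr_eq0 => /orP[] /eqP; [left | right].
Qed.

Lemma sqrt_exists (x : K) : exists y, y ^+ 2 = x.
Proof.
have /imageP[y _ ->] : x \in codom (fun y : K => y ^+ 2).
  by rewrite (inj_card_onto (sqr_inj_pchar2 charK)).
by exists y.
Qed.

Definition trace_poly : {poly K} := \sum_(i < m) 'X^(2 ^ i).

Lemma horner_trace_poly x : trace_poly.[x] = tr x.
Proof.
rewrite abs_traceE horner_sum; apply: eq_bigr => i _.
by rewrite hornerXn.
Qed.

(** Additive Hilbert 90.  If [x] is a root of the trace polynomial [T], then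
    [X^2 + X - x] divides [T(X^2 + X) = X^q - X], which splits over [K], so it
    has a root in [K]. *)
Lemma artin_schreier_exists x : tr x = 0 -> exists u, u ^+ 2 + u = x.
Proof.
move=> trx0; pose p : {poly K} := 'X^2 + 'X.
have charP : 2%N \in [pchar {poly K}] by rewrite pchar_poly.
have compE : trace_poly \Po p = 'X^#|K| - 'X.
  rewrite /trace_poly cardK raddf_sum /= (oppr_pchar2 charP).
  rewrite -(telescope_artin_schreier charP); apply: eq_bigr => i _.
  exact: comp_Xn_poly.
have szp : size (p - x%:P) = 3.
  by rewrite -addrA size_polyDl ?size_polyXn // size_XsubC.
have : p - x%:P %| 'X^#|K| - 'X.
  have : 'X - x%:P %| trace_poly by apply/polyXsubCP; rewrite horner_trace_poly.
  by move/(dvdp_comp_poly p); rewrite compE rmorphB /= comp_polyX comp_polyC.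
rewrite finField_genPoly => /dvdp_prod_XsubC[b].
move: (mask b _) => [|u s] pE.
  by move/eqp_size: pE; rewrite szp big_nil size_poly1.
exists u; apply/eqP; rewrite -subr_eq0; move/eqp_root/(_ u): pE.
by rewrite big_cons rootM root_XsubC eqxx /root !hornerE => ->.
Qed.

(** The trace polynomial has degree [q / 2], so at most [q / 2] elements have
    trace 0, and the others have trace 1. *)
Lemma abs_trace1_card : (2 ^ m.-1 <= #|[pred x | tr x == 1%R]|)%N.
Proof.
have m_gt0 : (0 < m)%N by move: (finNzRing_gt1 K); rewrite cardK; case: (m).
have card0 : (#|[pred x | tr x == 0%R]| <= 2 ^ m.-1)%N.
  have coefT : trace_poly`_(2 ^ m.-1) = 1.
    have ltm : (m.-1 < m)%N by rewrite prednK.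
    rewrite coef_sum (bigD1 (Ordinal ltm)) //= coefXn eqxx big1 ?addr0 //.
    by move=> i; rewrite -val_eqE /= coefXn eqn_exp2l // eq_sym => /negPf->.
  have szT : (size trace_poly <= (2 ^ m.-1).+1)%N.
    apply: (leq_trans (size_sum _ _ _)); apply/bigmax_leqP => i _.
    by rewrite size_polyXn ltnS leq_exp2l // -ltnS prednK.
  rewrite -ltnS cardE (leq_trans _ szT) //; apply: max_poly_roots.
  - by apply: contra_eq_neq coefT => ->; rewrite coef0 eq_sym oner_eq0.
  - by apply/allP => x; rewrite mem_enum inE /root horner_trace_poly.
  - exact: enum_uniq.
have : (2 ^ m = #|[pred x | tr x == 0%R]| + #|[pred x | tr x == 1%R]|)%N.
  rewrite -cardK -(cardC [pred x | tr x == 0%R]); congr (_ + _)%N.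
  apply: eq_card => x; rewrite !inE.
  by case: (abs_trace_bool x) => ->; rewrite eqxx ?oner_eq0 // eq_sym oner_eq0.
rewrite -{1}(prednK m_gt0) expnS mul2n -addnn => E.
by rewrite -(leq_add2l (2 ^ m.-1)) E leq_add2r.
Qed.

(** With [q = 2 ^ n.+1], the function [k ^ (q/2) * (tr (mu / k) + e)] is
    polynomial of degree at most [q / 2].  On the elements of trace 1 it keeps its
    values when [e] times the polynomial [tr X + 1], which vanishes there, is
    added; this cancels the term of degree [q / 2].  The result [Q] has
    coefficient [mu] in degree [q / 2 - 1], because [q / 2 - 1] is not a power of 2
    once [q >= 8], and so it cannot have [q / 2] roots.  For [q = 4] and [mu = 1]
    the conclusion fails. *)
Lemma trace_inv_nonconstant (mu e : K) : (2 < m)%N -> mu != 0 ->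
  ~ (forall k, tr k = 1 -> tr (mu / k) = e).
Proof.
case: m cardK abs_traceE abs_trace1_card => [//|n] cK trE card1; rewrite ltnS.
move=> n_ge2 mu_neq0 const; rewrite /= in card1.
pose P : {poly K} := \sum_(i < n.+1) mu ^+ (2 ^ i) *: 'X^(2 ^ n - 2 ^ i).
(* [T] is [tr X + 1] without its leading term ['X^(2 ^ n)]. *)
pose T : {poly K} := \sum_(i < n) 'X^(2 ^ i) + 1.
pose Q := P + e *: T.
have rootQ k : tr k = 1 -> root Q k.
  move=> trk; have k_neq0 := abs_trace1_neq0 trk.
  have Pk : P.[k] = k ^+ (2 ^ n) * e.
    rewrite -(const k trk) trE mulr_sumr horner_sum; apply: eq_bigr => i _.
    rewrite hornerZ hornerXn expr_div_n mulrCA -expfB_cond //.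
      by rewrite (negPf k_neq0) leq_exp2l // -ltnS.
  have Tk : T.[k] = k ^+ (2 ^ n).
    rewrite hornerD hornerC horner_sum.
    move: trk; rewrite trE big_ord_recr /= => trk.
    rewrite -[in LHS]trk addrA.
    under eq_bigr do rewrite hornerXn.
    by rewrite (addrr_pchar2 charK) add0r.
  by rewrite /root hornerD hornerZ Pk Tk mulrC (addrr_pchar2 charK).
have szQ : (size Q <= 2 ^ n)%N.
  apply: (leq_trans (size_polyD _ _)); rewrite geq_max; apply/andP; split.
    apply: (leq_trans (size_sum _ _ _)); apply/bigmax_leqP => i _.
    apply: (leq_trans (size_scale_leq _ _)); rewrite size_polyXn.
    by rewrite ltn_subrL !expn_gt0.
  apply: (leq_trans (size_scale_leq _ _)).
  apply: (leq_trans (size_polyD _ _)); rewrite geq_max size_poly1 expn_gt0 andbT.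
  apply: (leq_trans (size_sum _ _ _)); apply/bigmax_leqP => i _.
  by rewrite size_polyXn ltn_exp2l.
have coefQ : Q`_(2 ^ n - 1) = mu.
  have lt1 : (2 < 2 ^ n - 1)%N.
    by rewrite ltn_subRL (leq_trans (_ : 3 < 2 ^ 2)%N) // leq_exp2l.
  have odd1 : odd (2 ^ n - 1).
    by rewrite oddB ?expn_gt0 // oddX /= orbF; case: (n) n_ge2.
  have -> : Q`_(2 ^ n - 1) = P`_(2 ^ n - 1) + e * T`_(2 ^ n - 1).
    by rewrite coefD coefZ.
  have -> : T`_(2 ^ n - 1) = 0.
    rewrite coefD coef1 (gtn_eqF (ltn_trans _ lt1)) // addr0 coef_sum.
    rewrite big1 // => i _.
    rewrite coefXn; case: eqP => // E; move: lt1 odd1; rewrite E.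
    by case: (val i) => [|j] //; rewrite oddX.
  rewrite mulr0 addr0 coef_sum big_ord_recl /= coefZ coefXn eqxx mulr1 expr1.
  rewrite big1 ?addr0 // => i _.
  rewrite coefZ coefXn; case: eqP => [E|]; last by rewrite mulr0.
  have le1 : (1 <= 2 ^ n)%N by rewrite expn_gt0.
  have le2 : (2 ^ bump 0 i <= 2 ^ n)%N by rewrite leq_exp2l // ltn_ord.
  move/(congr1 (fun j => 2 ^ n - j)%N): E; rewrite !subKn //.
  by move/eqP; rewrite (@eqn_exp2l 2 0).
have Q_neq0 : Q != 0 by apply: contraNneq mu_neq0 => Q0; rewrite -coefQ Q0 coef0.
have: (#|[pred x | tr x == 1%R]| < size Q)%N.
  rewrite cardE; apply: max_poly_roots => //; last exact: enum_uniq.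
  by apply/allP => x; rewrite mem_enum inE => /eqP; apply: rootQ.
by move/leq_trans/(_ szQ); rewrite ltnNge card1.
Qed.

Lemma trace_inv_surjective (mu d : K) : (2 < m)%N -> mu != 0 ->
  d = 0 \/ d = 1 -> exists2 k, tr k = 1 & tr (mu / k) = d.
Proof.
move=> m_gt2 mu_neq0 d_bool.
have [k /andP[/eqP kP /eqP kd]|none] :=
  pickP [pred k | (tr k == 1) && (tr (mu / k) == d)].
  by exists k.
(* [d + 1] is the value other than [d] in the prime field. *)
case: (@trace_inv_nonconstant mu (d + 1)) => // k kP.
move: (none k); rewrite /= kP eqxx /=.
case: (abs_trace_bool (mu / k)) d_bool => -> [] ->; rewrite ?eqxx //.
  by rewrite (addrr_pchar2 charK).
by rewrite add0r.
Qed.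

(** The substitution [n = ka / k] turns the two conditions into conditions on
    [tr k] and [tr (la * ka / k)]. *)
Lemma abs_trace_pair (ka la d : K) : (2 < m)%N -> ka != 0 -> la != 0 ->
  d = 0 \/ d = 1 -> exists2 n, tr (ka / n) = 1 & tr (la * n) = d.
Proof.
move=> m_gt2 ka0 la0 d01.
have [|k k1 kd] := @trace_inv_surjective (la * ka) d m_gt2 _ d01.
  by rewrite mulf_neq0.
by exists (ka / k); rewrite ?mulrA // invf_div mulrCA mulfV // mulr1.
Qed.

(** * Rational points of the conic with prescribed traces *)

Lemma succ_bool (d : K) : d = 0 \/ d = 1 -> 1 + d = 0 \/ 1 + d = 1.
Proof.
by case=> ->; [right | left]; rewrite ?addr0 ?(addrr_pchar2 charK).
Qed.

(** Over F_4, [tr c^-1 = 0] means [c = 1].  So [a = b], and the last hypothesis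
    excludes [a = 0] and [a = 1], which leaves the two roots of [a^2 + a = 1]; the
    point is [t = a + 1], [w = a]. *)
Lemma conic_point_card4 (a b c : K) : m = 2%N ->
    c = a + b + 1 -> c != 0 -> tr c^-1 = 0 -> b ^+ 2 != a * c ^+ 2 ->
  exists t w, [/\ tr t^-1 = 1, tr w^-1 = 1 & conic a b t w = c ^+ 2].
Proof.
move=> m2 cE c0 trc nab.
have trE x : tr x = x + x ^+ 2 by rewrite abs_traceE m2 big_ord_recl big_ord1.
have c1 : c = 1.
  apply: invr_inj; rewrite invr1; apply: (mulfI (invr_neq0 c0)).
  by rewrite mulr1 -expr2; apply/esym/(eq_pchar2 charK); rewrite -trE.
have ab : a = b.
  apply: (eq_pchar2 charK); apply: (addIr 1).
  by rewrite -cE c1 add0r.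
rewrite c1 -ab expr1n mulr1 in nab *.
have a0 : a != 0 by apply: contraNneq nab => ->; rewrite expr0n.
have a1 : a + 1 != 0.
  by apply: contraNneq nab => /(eq_pchar2 charK) ->; rewrite expr1n.
have aa : a * (a + 1) = 1.
  have : a ^+ 2 ^+ 2 = a by rewrite -exprM -[RHS]expf_card cardK m2.
  move=> a4; apply: (mulfI a0); apply: (mulfI a1).
  have -> : (a + 1) * (a * (a * (a + 1))) = a ^+ 2 ^+ 2 + a ^+ 2.
    char2_ring charK.
  by rewrite a4; ring.
exists (a + 1), a.
have aV : a^-1 = a + 1 by apply: (mulfI a0); rewrite mulfV.
have a1V : (a + 1)^-1 = a by apply: (mulfI a1); rewrite mulfV // mulrC.
have aa1 : a + a ^+ 2 = 1 by rewrite -aa; ring.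
split; rewrite ?aV ?a1V ?trE //.
  by rewrite -[RHS]aa1; char2_ring charK.
by rewrite /conic; char2_ring charK.
Qed.

(** The form is then the square of [t + sqrt a * w], so the conic is the double
    line [t = c + sqrt a * w]. *)
Lemma conic_point_b0 (a b c : K) : (2 < m)%N -> b = 0 -> c != 0 ->
    tr c^-1 = 0 -> b ^+ 2 != a * c ^+ 2 ->
  exists t w, [/\ tr t^-1 = 1, tr w^-1 = 1 & conic a b t w = c ^+ 2].
Proof.
move=> m_gt2 b0 c0 trc nab.
have [al alE] := sqrt_exists a.
have acb01 := succ_bool (abs_trace_bool (al / c)).
have al0 : al != 0.
  by apply: contraNneq nab => al0; rewrite b0 -alE al0 !expr0n mul0r.
have [||n n1 nd] := abs_trace_pair m_gt2 _ _ acb01 (ka := al / c) (la := c^-1).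
- by rewrite mulf_neq0 ?invr_eq0.
- by rewrite invr_eq0.
(* [v] is [1 / w]. *)
pose v := c^-1 * n + al / c.
have trv : tr v = 1 by rewrite abs_traceD nd -addrA (addrr_pchar2 charK) addr0.
have v0 := abs_trace1_neq0 trv.
have n0 : n != 0.
  by move/abs_trace1_neq0: n1; rewrite mulf_eq0 invr_eq0 negb_or => /andP[].
have vE : c * v = n + al by rewrite /v; field.
exists (n / v), v^-1; split; rewrite ?invrK //.
  rewrite -[RHS]n1 -[RHS]add0r -trc -abs_traceD; congr tr.
  have -> : (n / v)^-1 = c * v / (c * n) by field; rewrite ?c0 ?n0 ?v0.
  by rewrite vE; field; rewrite ?c0 ?n0.
rewrite /conic b0 mul0r mul0r addr0 -alE.
have -> : (n / v) ^+ 2 + al ^+ 2 * v^-1 ^+ 2 = ((n + al) / v) ^+ 2.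
  by rewrite !expr_div_n [(n + al) ^+ 2](sqrrD_pchar2 charK) mulrDl exprVn; ring.
by rewrite -vE mulfK.
Qed.

(** The lines [t = c + s w] through the point [(c, 0)] parametrise the conic; with
    [n = s + sqrt a] and [N = n^2 + b n + b (sqrt a)], the second intersection is
    [t = c n^2 / N], [w = b c / N].  Hence [1/t = 1/c + (b/c)/n + (b (sqrt a)/c)/n^2]
    and [1/w = n^2/(b c) + n/c + sqrt a/c]; the trace is invariant under squaring,
    so the square terms may be replaced by their roots. *)
Lemma conic_point_bn0 (a b c : K) : (2 < m)%N -> b != 0 ->
    c = a + b + 1 -> c != 0 -> tr c^-1 = 0 -> b ^+ 2 != a * c ^+ 2 ->
  exists t w, [/\ tr t^-1 = 1, tr w^-1 = 1 & conic a b t w = c ^+ 2].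
Proof.
move=> m_gt2 b0 cE c0 trc nab.
have [al alE] := sqrt_exists a.
have acb01 := succ_bool (abs_trace_bool (al / c)).
have [ro roE] := sqrt_exists (b * al / c).
have [si siE] := sqrt_exists (b * c)^-1.
have [||n n1 nd] :=
  abs_trace_pair m_gt2 _ _ acb01 (ka := b / c + ro) (la := c^-1 + si).
- apply: contraNneq nab => /(eq_pchar2 charK) e; apply/eqP.
  have -> : b = al * c.
    apply: (mulfI b0).
    have -> : b * b = (b / c) ^+ 2 * c ^+ 2 by field.
    by rewrite e roE; field.
  by rewrite exprMn alE.
- apply: contraNneq nab => /(eq_pchar2 charK) e; apply/eqP.
  have cb : c = b.
    have : (c^-1) ^+ 2 = (b * c)^-1 by rewrite e.
    by rewrite exprVn => /invr_inj; rewrite expr2 => /mulIf; exact.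
  suff -> : a = 1 by rewrite mul1r cb.
  apply: (eq_pchar2 charK); apply: (addrI b).
  by rewrite addr0 -[RHS]cb cE; ring.
(* [v] is [1 / w]. *)
pose v := n ^+ 2 / (b * c) + n / c + al / c.
have trv : tr v = 1.
  move: nd; rewrite mulrDl abs_traceD -[tr (si * n)]abs_trace_sqr exprMn siE.
  rewrite -abs_traceD => nd; rewrite abs_traceD.
  rewrite [X in tr X + _](_ : _ = c^-1 * n + (b * c)^-1 * n ^+ 2); last by ring.
  by rewrite nd -addrA (addrr_pchar2 charK) addr0.
have v0 := abs_trace1_neq0 trv.
have n0 : n != 0.
  by move/abs_trace1_neq0: n1; rewrite mulf_eq0 invr_eq0 negb_or => /andP[].
have vE : b * c * v = n ^+ 2 + b * (n + al).
  by rewrite /v; field; rewrite ?c0 ?b0.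
exists (n ^+ 2 / (b * v)), v^-1; split; rewrite ?invrK //.
  move: n1; rewrite mulrDl abs_traceD -[tr (ro / n)]abs_trace_sqr expr_div_n roE.
  move=> n1; rewrite -[RHS]n1 -[RHS]add0r -trc -!abs_traceD; congr tr.
  have -> : (n ^+ 2 / (b * v))^-1 = b * c * v / (c * n ^+ 2).
    by field; rewrite ?c0 ?n0 ?v0 ?b0.
  by rewrite vE; field; rewrite ?c0 ?n0 ?b0.
have -> : c ^+ 2 = (b * c * v) ^+ 2 / (b * v) ^+ 2.
  by field; rewrite ?v0 ?b0.
rewrite vE /conic -alE.
have -> : (n ^+ 2 + b * (n + al)) ^+ 2
    = n ^+ 2 ^+ 2 + b ^+ 2 * n ^+ 2 + b ^+ 2 * al ^+ 2 by char2_ring charK.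
by field; rewrite ?c0 ?v0 ?b0.
Qed.

Lemma conic_point (a b c : K) :
    c = a + b + 1 -> c != 0 -> tr c^-1 = 0 -> b ^+ 2 != a * c ^+ 2 ->
  exists t w, [/\ tr t^-1 = 1, tr w^-1 = 1 & conic a b t w = c ^+ 2].
Proof.
move=> cE c0 trc nab.
have [m_gt2|m_le2] := ltnP 2 m.
  have [b0|b0] := eqVneq b 0; last exact: conic_point_bn0.
  exact: conic_point_b0.
have [m2|m_neq2] := eqVneq m 2%N; first exact: conic_point_card4.
case: m m_le2 m_neq2 cardK abs_traceE => [|[|[|//]]] // _ _ cK trE.
  by move: (finNzRing_gt1 K); rewrite cK.
by move/eqP: trc; rewrite trE big_ord1 expr1 invr_eq0 (negPf c0).
Qed.

End AbsTrace2.

(** * The norm-one group of a quadratic extension *)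

Section Trinomial.
Variables (L : finFieldType) (m : nat).
Hypothesis cardL : #|L| = ((2 ^ m) ^ 2)%N.

Let cardL2 : #|L| = (2 ^ (m * 2))%N. Proof. by rewrite cardL -expnM. Qed.
Let charL : 2%N \in [pchar L] := card_finPcharP cardL2 isT.

Local Notation bar x := (x ^+ (2 ^ m)).

Lemma barK (x : L) : bar (bar x) = x.
Proof. by rewrite -exprM mulnn -cardL expf_card. Qed.

Lemma barD (x y : L) : bar (x + y) = bar x + bar y.
Proof. exact: exprD_frobenius. Qed.

Lemma bar_fixed_artin_schreier (u g : L) :
  bar g = g -> u ^+ 2 + u = g ^+ 2 + g -> bar u = u.
Proof.
move=> gF ug.
have : (u + g) * (u + g + 1) = 0.
  have -> : (u + g) * (u + g + 1) = (u ^+ 2 + u) + (g ^+ 2 + g).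
    by char2_ring charL.
  by rewrite ug (addrr_pchar2 charL).
move/eqP; rewrite mulf_eq0 => /orP[] /eqP.
  by move/(eq_pchar2 charL) => ->.
rewrite -addrA => /(eq_pchar2 charL) ->.
by rewrite barD expr1n gF.
Qed.

Lemma norm1_neq0 (y : L) : bar y * y = 1 -> y != 0.
Proof. by apply: contra_eq_neq => ->; rewrite mulr0 eq_sym oner_eq0. Qed.

Lemma norm1_ratio (x : L) : x != 0 -> bar (bar x / x) * (bar x / x) = 1.
Proof.
by move=> x0; rewrite exprMn exprVn barK; field; rewrite x0 expf_neq0.
Qed.

(** For [y <> 1] the element [1 / (1 + y)] works: [bar (1 + y) = (1 + y) / y]. *)
Lemma norm1_hilbert90 (y : L) : bar y * y = 1 ->
  exists2 x, x != 0 & bar x = y * x.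
Proof.
move=> yN; have [->|yn1] := eqVneq y 1.
  by exists (1 : L); rewrite ?oner_eq0 // expr1n mulr1.
have y10 : 1 + y != 0.
  by apply: contraNneq yn1 => /(eq_pchar2 charL) <-.
exists (1 + y)^-1; first by rewrite invr_eq0.
have yb : bar (1 + y) * y = 1 + y.
  by rewrite barD expr1n mulrDl yN mul1r addrC.
have B0 : bar (1 + y) != 0 by rewrite expf_neq0.
by rewrite exprVn; apply: (mulfI B0); rewrite mulfV // mulrA yb mulfV.
Qed.

Lemma bar_add_inv (y : L) : bar y * y = 1 -> bar (y + y^-1) = y + y^-1.
Proof.
move=> yN; have y0 := norm1_neq0 yN.
have yV : bar y = y^-1 by apply: (mulIf y0); rewrite yN mulVf.
by rewrite barD exprVn yV invrK addrC.
Qed.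

Lemma bar_norm1_fixed (y : L) : bar y * y = 1 -> bar y = y -> y = 1.
Proof. by move=> yN yF; apply: (sqrr_eq1_pchar2 charL); rewrite -yN yF. Qed.

(** With [t = z + 1/z], the quotient [u = z / t] solves [u^2 + u = 1 / t^2].  If
    [1 / t^2 = d^2 + d] as well, then [u] is [d] or [d + 1], hence is fixed by
    [bar], and so is [z]; but the only fixed element of norm 1 is 1. *)
Lemma norm1_not_artin_schreier (z d : L) : bar z * z = 1 -> bar d = d ->
  z != 1 -> (z + z^-1)^-1 ^+ 2 <> d ^+ 2 + d.
Proof.
move=> zN dF z1; have z0 := norm1_neq0 zN; set t := z + z^-1 => tE.
have t0 : t != 0 by apply: add_inv_neq0 charL _ z0 z1.
have tF : bar t = t := bar_add_inv zN.
have uF : bar (z / t) = z / t.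
  apply: (bar_fixed_artin_schreier dF).
  have tz : z ^+ 2 + t * z = 1.
    by rewrite /t mulrDl mulVf // addrA -expr2 (addrr_pchar2 charL) add0r.
  have -> : (z / t) ^+ 2 + z / t = (z ^+ 2 + t * z) / t ^+ 2 by field.
  by rewrite tz -tE exprVn mul1r.
move/eqP: z1; apply; apply: bar_norm1_fixed => //.
by rewrite -[z in RHS](mulfVK t0) -uF exprMn exprVn tF mulfVK.
Qed.

(** * Collisions of the trinomial and points of the conic *)

Variables (a b : L).
Hypotheses (aF : bar a = a) (bF : bar b = b).
Let c := a + b + 1.

Definition trinomial (x : L) := a * x + b * bar x + x ^+ (2 * 2 ^ m - 1).

(** The quotient form also holds at [x = 0], where both sides vanish. *)
Lemma trinomialE x : trinomial x = a * x + b * bar x + bar x ^+ 2 / x.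
Proof.
rewrite /trinomial; congr (_ + _).
have q_gt0 : (0 < 2 ^ m)%N by rewrite expn_gt0.
have [->|x0] := eqVneq x 0.
  rewrite invr0 mulr0 expr0n.
  by rewrite subn_eq0 leqNgt (leq_trans _ (leq_pmulr 2 q_gt0)).
rewrite expfB ?expr1 -?exprM 1?mulnC //.
by rewrite (leq_trans _ (leq_pmull 2 q_gt0)).
Qed.

Lemma trinomial0 : trinomial 0 = 0.
Proof. by rewrite trinomialE invr0 !mulr0 expr0n expn_eq0 /= !mulr0 !addr0. Qed.

Lemma trinomial_scale l x : bar l = l -> trinomial (l * x) = l * trinomial x.
Proof.
move=> lF; rewrite !trinomialE exprMn lF.
have [->|l0] := eqVneq l 0.
  by rewrite !mul0r expr0n /= !mul0r !mulr0 !addr0.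
have [->|x0] := eqVneq x 0.
  by rewrite !mulr0 invr0 !mulr0 expr0n expn_eq0 /= !mulr0 !addr0 mulr0.
by field; rewrite l0 x0.
Qed.

Lemma bar_trinomial x :
  bar (trinomial x) = a * bar x + b * x + x ^+ 2 / bar x.
Proof.
by rewrite trinomialE !barD !exprMn aF bF barK exprVn expr2.
Qed.

(** Numerator and denominator of the rational function of [y = bar x / x] that
    gives [bar (trinomial x) / trinomial x]. *)
Definition num y := a * y ^+ 2 + b * y + 1.
Definition den y := y ^+ 3 + b * y ^+ 2 + a * y.
Definition collision (x y : L) :=
  (x + y) ^+ 2 + b * (x * y + 1) * (x + y) + a * (x * y) ^+ 2
  + c ^+ 2 * (x * y) + a.

Lemma num_den_cross x y :
  num x * den y + num y * den x = (x + y) * collision x y.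
Proof. by rewrite /num /den /collision /c; char2_ring charL. Qed.

Lemma trinomial_den x : x != 0 ->
  trinomial x * (bar x / x) = x * den (bar x / x).
Proof. by move=> x0; rewrite trinomialE /den; field. Qed.

Lemma trinomial_num x : x != 0 ->
  bar (trinomial x) * (bar x / x) = x * num (bar x / x).
Proof.
move=> x0; rewrite bar_trinomial /num; field.
by rewrite x0 expf_neq0.
Qed.

(** Lift [y1] and [y2] to [x1] and [x2].  As [trinomial x1] and [trinomial x2] have
    the same ratio to their conjugates, their quotient [l] is fixed by [bar], and
    [trinomial (l * x2) = trinomial x1], while the ratios [y1] and [y2] differ. *)
Lemma collision_not_injective y1 y2 :
  bar y1 * y1 = 1 -> bar y2 * y2 = 1 -> y1 != y2 ->
  collision y1 y2 = 0 -> ~ injective trinomial.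
Proof.
move=> N1 N2 y12 C inj.
have [x1 x10 E1] := norm1_hilbert90 N1.
have [x2 x20 E2] := norm1_hilbert90 N2.
have F0 x : x != 0 -> trinomial x != 0.
  by apply: contraNneq => Fx; apply/eqP/inj; rewrite Fx trinomial0.
have yE1 : bar x1 / x1 = y1 by rewrite E1 mulfK.
have yE2 : bar x2 / x2 = y2 by rewrite E2 mulfK.
have lF : bar (trinomial x1 / trinomial x2) = trinomial x1 / trinomial x2.
  rewrite expr_div_n; apply/eqP; rewrite eqr_div ?expf_neq0 ?F0 //; apply/eqP.
  apply: (mulIf (mulf_neq0 (norm1_neq0 N1) (norm1_neq0 N2))).
  move: (trinomial_den x10) (trinomial_den x20).
  move: (trinomial_num x10) (trinomial_num x20).
  rewrite yE1 yE2 => n1 n2 d1 d2.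
  rewrite mulrACA n1 d2 [y1 * y2]mulrC.
  have cross : num y1 * den y2 = num y2 * den y1.
    by apply: (eq_pchar2 charL); rewrite num_den_cross C mulr0.
  have -> : trinomial x1 * bar (trinomial x2) * (y2 * y1)
      = trinomial x1 * y1 * (bar (trinomial x2) * y2) by ring.
  by rewrite d1 n2 mulrACA cross; ring.
have /inj x12 : trinomial (trinomial x1 / trinomial x2 * x2) = trinomial x1.
  by rewrite trinomial_scale // mulfVK // F0.
have l0 : trinomial x1 / trinomial x2 != 0.
  by rewrite mulf_neq0 ?invr_eq0 ?F0.
move: x12 lF l0; set l := _ / _ => x12 lF l0.
move/eqP: y12; apply; rewrite -yE1 -yE2 -x12 exprMn lF.
by rewrite -mulf_div mulfV // mul1r.
Qed.

Lemma collision_conic r z : r != 0 -> z != 0 ->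
  collision (r * z) (r / z)
    = r ^+ 2 * (conic a b (z + z^-1) (r + r^-1) + c ^+ 2).
Proof.
move=> r0 z0; rewrite /collision /conic.
apply: (eq_pchar2 charL).
have e2 : 2 = 0 :> L := natr_double_eq0 charL 1.
have e4 : 4 = 0 :> L := natr_double_eq0 charL 2.
field: e2 e4.
by rewrite r0 z0.
Qed.

Lemma conic_not_injective t w z r :
    bar z * z = 1 -> z != 1 -> bar r * r = 1 -> t = z + z^-1 -> w = r + r^-1 ->
  conic a b t w = c ^+ 2 -> ~ injective trinomial.
Proof.
move=> zN z1 rN tE wE C.
have z0 := norm1_neq0 zN; have r0 := norm1_neq0 rN.
apply: (@collision_not_injective (r * z) (r / z)).
- by rewrite exprMn mulrACA rN zN mulr1.
- by rewrite exprMn exprVn mulrACA rN -invfM zN invr1 mulr1.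
- apply: contraNneq z1 => /(mulfI r0) e; apply/eqP/(sqrr_eq1_pchar2 charL).
  by rewrite expr2 {2}e mulfV.
- by rewrite collision_conic // -tE -wE C (addrr_pchar2 charL) mulr0.
Qed.

(** The conditions say that the form splits over F_q and that the one pole of
    [1 / t] on the conic is of Artin-Schreier type.  For
    [b <> 0] and [e = b g t + a w + b], the equation of the conic reads
    [e^2 + e b t + b^2 t = 0], that is [1 / t = (b / e)^2 + b / e]. *)
Lemma conic_inv_artin_schreier (g t w : L) : bar g = g -> g ^+ 2 + g = (c ^+ 2)^-1 ->
    c != 0 -> b ^+ 2 = a * c ^+ 2 -> bar t = t -> bar w = w -> t != 0 ->
    conic a b t w = c ^+ 2 ->
  exists2 d, bar d = d & t^-1 ^+ 2 = d ^+ 2 + d.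
Proof.
move=> gF gE c0 bE tF wF t0 C.
have [b0|b0] := eqVneq b 0.
  have a0 : a = 0.
    move/eqP: bE; rewrite b0 expr0n eq_sym mulf_eq0 expf_eq0.
    by rewrite (negPf c0) orbF => /eqP.
  by exists g; rewrite // gE -C /conic a0 b0 !mul0r !addr0 exprVn.
pose e := b * g * t + a * w + b.
have eF : bar e = e by rewrite /e !barD !exprMn aF bF gF tF wF.
have ag : b ^+ 2 * (g ^+ 2 + g) = a by rewrite gE bE mulfK // expf_neq0.
have eE : b ^+ 2 * t + e * b * t = e ^+ 2.
  apply: (eq_pchar2 charL).
  have -> : b ^+ 2 * t + e * b * t + e ^+ 2
      = b ^+ 2 * (g ^+ 2 + g) * t ^+ 2 + a * (b * w * t + a * w ^+ 2) + b ^+ 2.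
    by rewrite /e; char2_ring charL.
  rewrite ag bE -mulrDr addrA -/(conic a b t w) C.
  exact: (addrr_pchar2 charL).
have e0 : e != 0.
  apply: contra_eq_neq eE => ->.
  by rewrite !mul0r addr0 expr0n mulf_neq0 ?expf_neq0.
exists ((b / e) ^+ 2); first by rewrite exprAC exprMn exprVn bF eF.
rewrite -(sqrrD_pchar2 charL); congr (_ ^+ 2).
have -> : (b / e) ^+ 2 + b / e = (b ^+ 2 + e * b) / e ^+ 2 by field.
apply: (mulfI t0); rewrite mulfV // mulrA mulrDr ![t * _]mulrC eE mulfV //.
by rewrite expf_neq0.
Qed.

(** A root [y] in the norm-one group of [y^2 + b y + a] is also a root of its
    conjugate reciprocal [a y^2 + b y + 1], which leaves [y = 1], excluded by
    [c <> 0], or [a = 1]; then [b = c = y + 1/y], excluded by the trace of [1/c]. *)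
Lemma trinomial_root_free (g : L) : bar g = g -> g ^+ 2 + g = (c ^+ 2)^-1 ->
    c != 0 -> b ^+ 2 = a * c ^+ 2 ->
  forall x, trinomial x = 0 -> x = 0.
Proof.
move=> gF gE c0 bE x; have [//|x0 Fx] := eqVneq x 0; exfalso.
pose y := bar x / x.
have yN : bar y * y = 1 := norm1_ratio x0.
have y0 := norm1_neq0 yN.
have ny : num y = 0.
  by apply: (mulfI x0); rewrite -trinomial_num // Fx expr0n expn_eq0 mul0r mulr0.
have dy : a + b * y + y ^+ 2 = 0.
  apply: (mulfI y0); apply: (mulfI x0); rewrite !mulr0.
  rewrite -[RHS](mul0r y) -Fx trinomial_den // -/y /den; ring.
have y1 : y != 1.
  by apply: contraNneq c0 => y1; rewrite -dy y1 /c; apply/eqP; ring.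
have /eqP : (a + 1) * (y + 1) ^+ 2 = 0.
  rewrite -[RHS](addr0 0) -{1}ny -dy /num; char2_ring charL.
rewrite mulf_eq0 expf_eq0 /= => /orP[] /eqP /(eq_pchar2 charL); last first.
  by move/eqP: y1.
move=> a1; have bc : b = c.
  by apply: (sqr_inj_pchar2 charL); rewrite /= bE a1 mul1r.
apply: (@norm1_not_artin_schreier y g) => //.
have yy : y + y^-1 = b.
  apply: (mulIf y0); rewrite mulrDl mulVf //; apply: (eq_pchar2 charL).
  by rewrite -dy a1; ring.
by rewrite yy bc exprVn gE.
Qed.

Lemma trinomial_inj (g : L) : bar g = g -> g ^+ 2 + g = (c ^+ 2)^-1 ->
    c != 0 -> b ^+ 2 = a * c ^+ 2 -> injective trinomial.
Proof.
move=> gF gE c0 bE x1 x2 F12.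
have rootF := trinomial_root_free gF gE c0 bE.
have [Fx|F10] := eqVneq (trinomial x1) 0.
  by rewrite (rootF _ Fx) (rootF x2) // -F12.
have F20 : trinomial x2 != 0 by rewrite -F12.
have x0 (x : L) : trinomial x != 0 -> x != 0.
  by apply: contraNneq => ->; rewrite trinomial0.
have x10 := x0 _ F10; have x20 := x0 _ F20.
pose y1 := bar x1 / x1; pose y2 := bar x2 / x2.
have yN1 : bar y1 * y1 = 1 := norm1_ratio x10.
have yN2 : bar y2 * y2 = 1 := norm1_ratio x20.
have y10 := norm1_neq0 yN1; have y20 := norm1_neq0 yN2.
have [y12|y12] := eqVneq y1 y2.
  have E (x : L) : x != 0 ->
      trinomial x = x * (a + b * (bar x / x) + (bar x / x) ^+ 2).
    by move=> nx; rewrite trinomialE; field.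
  have k0 : a + b * y1 + y1 ^+ 2 != 0.
    by move: F10; rewrite E // mulf_eq0 negb_or => /andP[].
  by apply: (mulIf k0); rewrite -[LHS]E // F12 y12 E.
exfalso.
(* Squaring is bijective, so [y1] and [y2] can be written [r * z] and [r / z]. *)
have [r rE] := sqrt_exists cardL2 (y1 * y2).
have r0 : r != 0.
  by apply: contra_eq_neq rE => ->; rewrite expr0n eq_sym mulf_neq0.
have rN : bar r * r = 1.
  apply: (sqrr_eq1_pchar2 charL); rewrite exprMn exprAC rE exprMn mulrACA.
  by rewrite yN1 yN2 mulr1.
pose z := y1 / r.
have z0 : z != 0 by rewrite mulf_neq0 ?invr_eq0.
have zN : bar z * z = 1.
  by rewrite exprMn exprVn mulrACA yN1 -invfM rN invr1 mulr1.
have rz : r * z = y1 by rewrite /z mulrCA mulfV // mulr1.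
have rzV : r / z = y2.
  apply: (mulfI y10); rewrite -rE -rz expr2; field.
  by rewrite z0.
have z1 : z != 1.
  by apply: contraNneq y12 => z1; rewrite -rz -rzV z1 invr1.
have C : conic a b (z + z^-1) (r + r^-1) = c ^+ 2.
  apply: (eq_pchar2 charL).
  have r20 : r ^+ 2 != 0 by rewrite expf_neq0.
  apply: (mulfI r20); rewrite -collision_conic // rz rzV mulr0.
  have y120 : y1 + y2 != 0 by apply: contraNneq y12 => /(eq_pchar2 charL) ->.
  apply: (mulfI y120); rewrite mulr0 -num_den_cross.
  have nE (x : L) : x != 0 ->
      num (bar x / x) = bar (trinomial x) * (bar x / x) / x.
    by move=> nx; rewrite trinomial_num // mulrAC mulfV // mul1r.
  have dE (x : L) : x != 0 ->
      den (bar x / x) = trinomial x * (bar x / x) / x.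
    by move=> nx; rewrite trinomial_den // mulrAC mulfV // mul1r.
  rewrite /y1 /y2 !nE // !dE // F12.
  set F := trinomial x2; set G := bar F.
  rewrite -[RHS](addrr_pchar2 charL (G * (y1 / x1) * (F * (y2 / x2)))) /y1 /y2.
  ring.
have t0 := add_inv_neq0 charL z0 z1.
have [d dF dE] := conic_inv_artin_schreier gF gE c0 bE
  (bar_add_inv zN) (bar_add_inv rN) t0 C.
exact: (norm1_not_artin_schreier zN dF z1 dE).
Qed.

End Trinomial.

(** * Descent to the base field *)

Section Quadratic.
Variables (F L : finFieldType) (m : nat).
Hypotheses (cardF : #|F| = (2 ^ m)%N) (cardL : #|L| = ((2 ^ m) ^ 2)%N).
Variable iota : {rmorphism F -> L}.

Let cardL2 : #|L| = (2 ^ (m * 2))%N. Proof. by rewrite cardL -expnM. Qed.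
Let charF : 2%N \in [pchar F] := card_finPcharP cardF isT.
Let charL : 2%N \in [pchar L] := card_finPcharP cardL2 isT.

Local Notation bar x := (x ^+ (2 ^ m)).

Lemma bar_iota x : bar (iota x) = iota x.
Proof. by rewrite -rmorphXn /= (expf_card2 cardF). Qed.

Lemma abs_trace_iota x : abs_trace 2 (iota x) = 0.
Proof.
rewrite (abs_traceE cardL2) muln2 -addnn big_split_ord /=.
rewrite [X in _ + X](eq_bigr (fun i : 'I_m => iota x ^+ (2 ^ i))).
  exact: (addrr_pchar2 charL).
by move=> i _; rewrite expnD exprM bar_iota.
Qed.

(** Every element of F_q has trace 0 in the quadratic extension, so
    [u^2 + u = 1 / t^2] is solvable there.  Since [1 / t^2] has trace 1 over F_q,
    the telescoping sum gives [bar u = u + 1]; then [z = t u] satisfies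
    [bar z = z + t] and [z (z + t) = 1]. *)
Lemma norm1_of_trace t : abs_trace 2 t^-1 = 1 ->
  exists z, [/\ bar z * z = 1, z != 1 & iota t = z + z^-1].
Proof.
move=> trt; have t0 : t != 0.
  by move: (abs_trace1_neq0 cardF trt); rewrite invr_eq0.
have it0 : iota t != 0 by rewrite fmorph_eq0.
have [u uE] := artin_schreier_exists cardL2 (abs_trace_iota (t^-1 ^+ 2)).
have ubar : bar u = u + 1.
  apply: (eq_pchar2 charL); rewrite addrA -(telescope_artin_schreier charL) uE.
  have -> : \sum_(i < m) iota (t^-1 ^+ 2) ^+ (2 ^ i) = 1.
    rewrite -(rmorph1 iota) -trt -(abs_trace_sqr cardF) (abs_traceE cardF).
    by rewrite rmorph_sum; apply: eq_bigr => i _; rewrite /= rmorphXn.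
  exact: (addrr_pchar2 charL).
pose z := iota t * u.
have zN : bar z * z = 1.
  rewrite exprMn bar_iota ubar.
  have -> : iota t * (u + 1) * z = iota t ^+ 2 * (u ^+ 2 + u) by rewrite /z; ring.
  by rewrite uE -rmorphXn -rmorphM -exprMn mulfV // expr1n rmorph1.
have z0 := norm1_neq0 zN.
have zV : z^-1 = z + iota t.
  apply: (mulIf z0); rewrite mulVf // -zN exprMn bar_iota ubar /z; ring.
exists z; split=> //.
  apply: contraNneq it0 => z1; move: zV; rewrite z1 invr1 -{1}[1]addr0.
  by move/addrI => <-.
by rewrite zV addrA (addrr_pchar2 charL) add0r.
Qed.

Lemma fmorph_trinomial (a b : F) x :
  (map_poly iota (a *: 'X + b *: 'X^(2 ^ m) + 'X^(2 * 2 ^ m - 1))).[x]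
    = trinomial m (iota a) (iota b) x.
Proof.
rewrite !rmorphD /= !linearZ /= map_polyX !map_polyXn.
by rewrite !hornerD !hornerZ hornerX !hornerXn.
Qed.

(** Left to right, [c <> 0] comes from [x = 1], [abs_trace 2 c^-1 = 0] from the point
    [(c, 0)] of the conic, and the last equation from [conic_point]. *)
Lemma trinomial_injP (a b : F) (c := a + b + 1) :
  injective (trinomial m (iota a) (iota b)) <->
  [/\ c != 0, abs_trace 2 c^-1 = 0 & b ^+ 2 = a * c ^+ 2].
Proof.
have cE : iota a + iota b + 1 = iota c by rewrite !rmorphD rmorph1.
split=> [inj|[c0 trc bE]]; last first.
  have [g gE] : exists g, g ^+ 2 + g = (c ^+ 2)^-1.
    apply: (artin_schreier_exists cardF).
    by rewrite -exprVn (abs_trace_sqr cardF).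
  apply: (trinomial_inj cardL (bar_iota a) (bar_iota b) (bar_iota g)).
  - by rewrite cE -!rmorphXn -fmorphV -rmorphD gE.
  - by rewrite cE fmorph_eq0.
  - by rewrite cE -!rmorphXn -rmorphM bE.
have c0 : c != 0.
  apply/eqP => c0; have /inj/eqP : trinomial m (iota a) (iota b) 1
      = trinomial m (iota a) (iota b) 0.
    by rewrite trinomial0 trinomialE !expr1n divr1 !mulr1 cE c0 rmorph0.
  by rewrite oner_eq0.
have coll t w z r : bar z * z = 1 -> z != 1 -> bar r * r = 1 ->
    iota t = z + z^-1 -> iota w = r + r^-1 ->
    conic a b t w = c ^+ 2 -> False.
  move=> zN z1 rN tE wE C.
  apply: (conic_not_injective cardL (bar_iota a) (bar_iota b) zN z1 rN tE wE) inj.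
  by rewrite cE /conic -!rmorphXn -!rmorphM -!rmorphD -/(conic a b t w) C.
have trc : abs_trace 2 c^-1 = 0.
  case: (abs_trace_bool cardF c^-1) => // trc.
  have [z [zN z1 zE]] := norm1_of_trace trc.
  case: (coll c 0 z 1 zN z1 _ zE); rewrite ?expr1n ?mulr1 //.
    by rewrite invr1 (addrr_pchar2 charL) rmorph0.
  by rewrite /conic mulr0 mul0r expr0n mulr0 !addr0.
split=> //; apply/eqP/negPn/negP => nE.
have [t [w [trt trw C]]] := conic_point cardF (erefl c) c0 trc nE.
have [z [zN z1 zE]] := norm1_of_trace trt.
have [r [rN _ rE]] := norm1_of_trace trw.
exact: (coll t w z r zN z1 rN zE rE C).
Qed.

(** If [a = 1] then [c = b] and the last equation is trivial; otherwise that
    equation is [(a + 1) b^2 = a (a + 1)^2], so [c^2 = a + 1], and [1 / c] has the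
    trace of its square. *)
Lemma conditions_split (a b : F) (c := a + b + 1) :
  [/\ c != 0, abs_trace 2 c^-1 = 0 & b ^+ 2 = a * c ^+ 2] <->
  [/\ (2 < 2 ^ m)%N, a != 1, abs_trace 2 (1 / (a + 1)) = 0
    & b ^+ 2 = a ^+ 2 + a] \/
  [/\ (2 < 2 ^ m)%N, a = 1, b != 0 & abs_trace 2 (1 / b) = 0].
Proof.
rewrite !div1r.
have c1 : a = 1 -> c = b.
  by move=> a1; rewrite /c a1; char2_ring charF.
have bE0 : b ^+ 2 = a ^+ 2 + a -> c ^+ 2 = a + 1.
  move=> bE; have -> : c ^+ 2 = b ^+ 2 + a ^+ 2 + 1.
    by rewrite /c; char2_ring charF.
  by rewrite bE; char2_ring charF.
split=> [[c0 trc bE]|].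
  have q_gt2 : (2 < 2 ^ m)%N.
    rewrite (@ltn_exp2l 2 1) // ltnNge; apply: contra_neqN c0 => m1.
    apply/eqP; rewrite -invr_eq0 -trc (abs_traceE cardF).
    case: m m1 cardF => [|[|//]] _; last by rewrite big_ord1.
    by move/eqP; rewrite eqn_leq leqNgt (finNzRing_gt1 F).
  have [a1|a1] := eqVneq a 1; [right | left].
    by split=> //; rewrite -c1.
  have bE' : b ^+ 2 = a ^+ 2 + a.
    have a10 : a + 1 != 0 by apply: contraNneq a1 => /(eq_pchar2 charF) ->.
    apply: (mulfI a10).
    have : a * c ^+ 2 = a * (a + 1) ^+ 2 + a * b ^+ 2.
      by rewrite /c; char2_ring charF.
    rewrite -bE => {}bE.
    rewrite mulrDl mul1r {2}bE addrCA (addrr_pchar2 charF) addr0; ring.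
  split=> //.
  by rewrite -(bE0 bE') -exprVn (abs_trace_sqr cardF).
case=> [[_ a1 tra bE]|[_ a1 b0 trb]].
  have cc := bE0 bE.
  have a10 : a + 1 != 0 by apply: contraNneq a1 => /(eq_pchar2 charF) ->.
  split.
  - by rewrite -sqrf_eq0 cc.
  - by rewrite -(abs_trace_sqr cardF) exprVn cc.
  - by rewrite cc bE; ring.
by rewrite c1 // a1 mul1r.
Qed.

End Quadratic.

Theorem theoremB (m q : nat) (hq : q = (2 ^ m)%N)
    (F L : finFieldType) (hF : #|F| = q) (hL : #|L| = (q ^ 2)%N)
    (iota : {rmorphism F -> L}) (a b : F) :
  let f : {poly F} := a *: 'X + b *: 'X^q + 'X^(2 * q - 1) in
  permutation_poly (map_poly iota f) <->
  [/\ (2 < q)%N, a != 1, abs_trace 2 (1 / (a + 1)) = 0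
    & b ^+ 2 = a ^+ 2 + a] \/
  [/\ (2 < q)%N, a = 1, b != 0 & abs_trace 2 (1 / b) = 0].
Proof.
move: hF hL; rewrite hq => cardF cardL f.
have fE : (fun x : L => (map_poly iota f).[x]) =1 trinomial m (iota a) (iota b).
  exact: fmorph_trinomial.
apply: iff_trans (conditions_split cardF a b).
apply: iff_trans (trinomial_injP cardF cardL iota a b).
rewrite /permutation_poly; split=> [/bij_inj fI | fI].
  exact: (eq_inj fI fE).
by apply: injF_bij; apply: (eq_inj fI) => x; rewrite fE.
Qed.
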